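(* Let $G$ be a connected graph belonging to $\mathbf{W}_2$. Then $G$ is $2$-quasi-regularizable if and only if $$n(G)\ge 3\alpha(G).$$
   Context: All graphs are finite, undirected and simple. $V(G)$ is the vertex set, $n(G)=|V(G)|$, and $\alpha(G)$ is the maximum cardinality of an independent set of $G$. A maximum independent set is an independent set of cardinality $\alpha(G)$. The empty set is an independent set. For $A\subseteq V(G)$ the open neighborhood is $N_G(A)=\{v\in V(G)\setminus A : uv\in E(G)\text{ for some }u\in A\}$. For an integer $p\ge1$, a graph $G$ belongs to $\mathbf{W}_p$ if $n(G)\ge p$ and, for every $p$ pairwise disjoint independent sets $A_1,\ldots,A_p$ of $G$ (possibly empty), there exist $p$ pairwise disjoint maximum independent sets $S_1,\ldots,S_p$ of $G$ such that $A_i\subseteq S_i$ for every $i$. For a real number $\lambda>0$, a graph $G$ is $\lambda$-quasi-regularizable if $\lambda|A|\le|N_G(A)|$ for every independent set $A$ of $G$. *)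

(* Defs.v *)
From mathcomp Require Import all_boot all_order all_algebra.
From mathcomp Require Import reals.

Set Implicit Arguments.
Unset Strict Implicit.
Unset Printing Implicit Defensive.

Import Order.TTheory GRing.Theory Num.Theory.

(* A finite simple graph is an adjacency relation [e] on a finType [T] that is
   symmetric and irreflexive; the last two conditions are hypotheses of the
   results, not of the definitions below. *)

Definition independent (T : finType) (e : rel T) (A : {set T}) : bool :=
  [forall x in A, forall y in A, ~~ e x y].

Definition alpha (T : finType) (e : rel T) : nat :=
  \max_(A : {set T} | independent e A) #|A|.

Definition maximum_independent (T : finType) (e : rel T) (A : {set T}) : bool :=
  independent e A && (#|A| == alpha e).

Definition open_nbhd (T : finType) (e : rel T) (A : {set T}) : {set T} :=
  [set v in ~: A | [exists u in A, e u v]].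

Definition connected_graph (T : finType) (e : rel T) : Prop :=
  (0 < #|T|)%N /\ forall x y : T, connect e x y.

Definition pairwise_disjoint (T : finType) (p : nat) (A : 'I_p -> {set T}) :
    Prop :=
  forall i j : 'I_p, i != j -> [disjoint A i & A j].

Definition in_W (p : nat) (T : finType) (e : rel T) : Prop :=
  [/\ (0 < p)%N, (p <= #|T|)%N &
    forall A : 'I_p -> {set T},
      (forall i, independent e (A i)) -> pairwise_disjoint A ->
      exists S : 'I_p -> {set T},
        [/\ forall i, maximum_independent e (S i),
            pairwise_disjoint S &
            forall i, A i \subset S i]].

Definition quasi_regularizable (R : realType) (lam : R) (T : finType)
    (e : rel T) : Prop :=
  (0 < lam)%R /\
  forall A : {set T}, independent e A ->
    (lam * #|A|%:R <= #|open_nbhd e A|%:R)%R.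

(* Main.v *)
Require Import Defs.
From mathcomp Require Import all_boot all_order all_algebra.
From mathcomp Require Import reals.
From mathcomp Require Import zify.

(** Call an independent set A deficient when |N(A)| < 2|A|.  If G is
2-quasi-regularizable, a maximum independent set S is not deficient, so
n >= |S| + |N(S)| >= 3 alpha.  For the converse the key fact is that in a
W_2 graph every deficient set contains a deficient set B whose closed
neighbourhood N[B] is a union of connected components
([deficient_contains_closed]).  When G is connected, N[B] is then the whole
graph, and n = |B| + |N(B)| < 3|B| <= 3 alpha.

What is used of W_2 is stable under passing to the graph G - N[I], for I
independent: all maximal independent sets have the same size, and every
vertex of an independent set has a private neighbour.  Hence the key fact can
be proved by induction on induced subgraphs.  It reduces to showing that a
deficient set A of smallest cardinality has no edge leaving N[A]
([smallest_deficient_no_exit]).  Write D(B) = 2|B| - |N(B)|; private neighbours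
and minimality give D(A) = 1.

Suppose that x in N(A) is adjacent to some y outside N[A].  Deleting N[y]
removes from N(A) the nonempty set X = N(A) :&: N(y), so the deficiency of A
rises to |X| + 1 in Uy = G - N[y], while every nonempty proper subset of A has
deficiency at most |X| there.  By induction A splits into inclusion-minimal
deficient pieces B that are closed in Uy and have deficiency exactly 1.  All of
X is adjacent to A :\: B; so B has in G - N[A :\: B] the same neighbours as in
Uy, and the induction hypothesis there shows that N[B] within Uy has no edge to
G - N[A] ([piece_separated]).

Finally let S be a maximum independent set containing x.  On each piece S has at
most |B| vertices; let A' collect the traces of S on the pieces where equality
holds.  Each other piece costs A' one unit of deficiency but loses S at least
one vertex ([transferable]).  As S has at least |A| vertices in N[A], those
losses are made up for by vertices of S in X, and these are not in N(A').
Comparing, A' is deficient; either it is smaller than A, or it has as many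
elements and deficiency at least 2, and both contradict minimality. *)

Set Implicit Arguments.
Unset Strict Implicit.
Unset Printing Implicit Defensive.

(* Cardinals become variables, so that only natural numbers are left to the
   arithmetic. *)
Ltac card_lia :=
  repeat match goal with
  | H : is_true (leq _ _) |- _ => revert H
  | H : @eq nat _ _ |- _ => revert H
  end;
  repeat match goal with |- context [@card ?U ?P] => generalize (@card U P) end;
  clear; intros; lia.

(** * Neighbourhoods in induced subgraphs *)
Section Graph.

Variables (T : finType) (e : rel T).
Hypotheses (e_sym : symmetric e) (e_irr : irreflexive e).

Implicit Types (U K A B F I J S : {set T}) (m : nat).

(** The subgraph induced on U is represented by the set U itself.  The set A is
not removed from [nbrs A]; for independent A this is the open neighbourhood. *)
Definition nbrs A : {set T} := [set v | [exists u in A, e u v]].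

Definition nb U A : {set T} := U :&: nbrs A.

Definition cl U A : {set T} := A :|: nb U A.

Definition far U A : {set T} := U :\: cl U A.

Definition closed_in U K : bool :=
  [forall u in K, forall v in U, e u v ==> (v \in K)].

Definition deficient U A : bool :=
  [&& independent e A, A \subset U & #|nb U A| < 2 * #|A|].

(** The consequences of W_2 that survive in G - N[I]: well-coveredness with
independence number m, and private neighbours.  In a W_2 graph a private
neighbour of a comes from a maximum independent set that contains J :\ a and
misses a. *)
Record private_well_covered U m : Prop := PrivateWellCovered {
  pwc_le : forall J, independent e J -> J \subset U -> #|J| <= m;
  pwc_extend : forall J, independent e J -> J \subset U ->
    exists S, [/\ J \subset S, S \subset U, independent e S & #|S| = m];
  pwc_private : forall J a, independent e J -> J \subset U -> a \in J ->
    exists b, [/\ b \in U, e a b & b \notin nbrs (J :\ a)]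
}.

Lemma indepP A :
  reflect (forall u v, u \in A -> v \in A -> ~~ e u v) (independent e A).
Proof.
apply: (iffP forall_inP) => [H u v uA vA | H u uA].
  by have /forall_inP := H u uA; apply.
by apply/forall_inP => v; exact: H.
Qed.

Lemma nbrsP A v : reflect (exists2 u, u \in A & e u v) (v \in nbrs A).
Proof. by rewrite inE; apply: (iffP exists_inP). Qed.

Lemma closedP U K :
  reflect (forall u v, u \in K -> v \in U -> e u v -> v \in K) (closed_in U K).
Proof.
apply: (iffP forall_inP) => [H u v uK vU uv | H u uK].
  by have /forall_inP/(_ v vU)/implyP := H u uK; apply.
by apply/forall_inP => v vU; apply/implyP; exact: H.
Qed.

Lemma in_nb U A v : (v \in nb U A) = (v \in U) && (v \in nbrs A).
Proof. by rewrite inE. Qed.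

Lemma in_cl U A v : (v \in cl U A) = (v \in A) || (v \in U) && (v \in nbrs A).
Proof. by rewrite in_setU in_nb. Qed.

Lemma in_far U A v :
  (v \in far U A) = [&& v \in U, v \notin A & v \notin nbrs A].
Proof.
rewrite in_setD in_cl.
by case: (v \in U); case: (v \in A); case: (v \in nbrs A).
Qed.

Lemma nbrs1 y v : (v \in nbrs [set y]) = e y v.
Proof.
apply/nbrsP/idP => [[u /set1P->]//|yv].
by exists y => //; rewrite set11.
Qed.

Lemma nbrsS A B : A \subset B -> nbrs A \subset nbrs B.
Proof.
move=> sAB; apply/subsetP => v /nbrsP[u uA uv].
by apply/nbrsP; exists u => //; exact: (subsetP sAB).
Qed.

Lemma nbrsU A B : nbrs (A :|: B) = nbrs A :|: nbrs B.
Proof.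
apply/setP=> v; rewrite in_setU; apply/nbrsP/orP.
  by case=> u /setUP[uA|uB] uv; [left|right]; apply/nbrsP; exists u.
by case=> /nbrsP[u uA uv]; exists u => //; rewrite in_setU uA ?orbT.
Qed.

Lemma nb0 U : nb U set0 = set0.
Proof.
apply/setP => v; rewrite in_nb in_set0; apply/negbTE/andP => -[_ /nbrsP[u]].
by rewrite in_set0.
Qed.

Lemma nbS U A B : A \subset B -> nb U A \subset nb U B.
Proof. by move=> sAB; apply: setIS; exact: nbrsS. Qed.

Lemma nbU U A B : nb U (A :|: B) = nb U A :|: nb U B.
Proof. by rewrite /nb nbrsU setIUr. Qed.

Lemma clU U A B : cl U (A :|: B) = cl U A :|: cl U B.
Proof. by rewrite /cl nbU setUACA. Qed.

Lemma cl_sub U A : A \subset U -> cl U A \subset U.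
Proof. by move=> sAU; rewrite subUset sAU subsetIl. Qed.

Lemma indepS A B : A \subset B -> independent e B -> independent e A.
Proof.
move=> /subsetP sAB /indepP iB.
by apply/indepP => u v uA vA; apply: iB; exact: sAB.
Qed.

Lemma indep1 y : independent e [set y].
Proof. by apply/indepP => u v /set1P-> /set1P->; rewrite e_irr. Qed.

Lemma indepU A B : independent e A -> independent e B ->
  (forall v, v \in B -> v \notin nbrs A) -> independent e (A :|: B).
Proof.
move=> /indepP iA /indepP iB sep.
have AB u v : u \in A -> v \in B -> ~~ e u v.
  by move=> uA vB; apply: contra (sep v vB) => uv; apply/nbrsP; exists u.
apply/indepP => u v /setUP[uA|uB] /setUP[vA|vB].
- exact: iA.
- exact: AB.
- by rewrite e_sym AB.
- exact: iB.
Qed.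

Lemma indep_nbrs A v : independent e A -> v \in A -> v \notin nbrs A.
Proof.
move=> /indepP iA vA; apply/nbrsP => -[u uA].
by apply/negP; exact: iA.
Qed.

Lemma disjoint_nb U A : independent e A -> [disjoint A & nb U A].
Proof.
move=> iA; rewrite disjoint_subset; apply/subsetP => v vA.
by rewrite inE in_nb (negPf (indep_nbrs iA vA)) andbF.
Qed.

Lemma cardsU_disjoint A B : [disjoint A & B] -> #|A :|: B| = #|A| + #|B|.
Proof. by move=> /disjoint_setI0 AB; rewrite cardsU AB cards0 subn0. Qed.

Lemma card_cl U A : independent e A -> #|cl U A| = #|A| + #|nb U A|.
Proof. by move=> iA; rewrite cardsU_disjoint // disjoint_nb. Qed.

Lemma far_sub U A : far U A \subset U.
Proof. exact: subsetDl. Qed.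

(** * Stability of private well-coveredness *)

(** An independent set J of G - N[I] becomes independent in G when I is added;
an extension or a private neighbour for I :|: J restricts to one for J. *)
Lemma pwc_far U m I : private_well_covered U m -> independent e I ->
  I \subset U -> private_well_covered (far U I) (m - #|I|).
Proof.
move=> [le ext priv] iI sIU.
have glue J : independent e J -> J \subset far U I ->
    [/\ independent e (I :|: J), I :|: J \subset U & #|I :|: J| = #|I| + #|J|].
  move=> iJ /subsetP sJ; split.
  - by apply: indepU => // v /sJ; rewrite in_far => /and3P[].
  - by rewrite subUset sIU; apply/subsetP => v /sJ; rewrite in_far => /and3P[].
  - apply: cardsU_disjoint; rewrite disjoint_sym disjoint_subset.
    by apply/subsetP => v /sJ; rewrite in_far inE => /and3P[].
split.
- move=> J iJ sJ; have [iIJ sIJ cIJ] := glue J iJ sJ.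
  by have := le _ iIJ sIJ; card_lia.
- move=> J iJ sJ; have [iIJ sIJ _] := glue J iJ sJ.
  have [S [/subUsetP[sIS sJS] sSU iS cS]] := ext _ iIJ sIJ.
  exists (S :\: I); split.
  + rewrite subsetD sJS disjoint_subset.
    by apply/subsetP => v /(subsetP sJ); rewrite in_far inE => /and3P[].
  + apply/subsetP => v /setDP[vS vI]; rewrite in_far vI (subsetP sSU) //=.
    by apply: contra (indep_nbrs iS vS); apply/subsetP/nbrsS.
  + by apply: indepS iS; exact: subsetDl.
  + by rewrite cardsD (setIidPr sIS) cS.
- move=> J a iJ sJ aJ; have [iIJ sIJ _] := glue J iJ sJ.
  have [|b [bU ab bp]] := priv _ a iIJ sIJ; first by rewrite in_setU aJ orbT.
  have /and3P[_ aI aNI] : [&& a \in U, a \notin I & a \notin nbrs I].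
    by rewrite -in_far (subsetP sJ).
  have bp' K : K \subset I :|: J -> a \notin K -> b \notin nbrs K.
    move=> /subsetP sK aK; apply: contra bp; apply/subsetP/nbrsS.
    apply/subsetP => v vK; rewrite in_setD1 sK // andbT.
    by apply: contraNneq aK => <-.
  exists b; split => //.
  + rewrite in_far bU bp' ?subsetUl // andbT.
    by apply: contra aNI => bI; apply/nbrsP; exists b => //; rewrite e_sym.
  + by apply: bp'; rewrite ?setD11 // (subset_trans (subsetDl _ _)) ?subsetUr.
Qed.

(** A union of components K is U - N[I] for I the part outside K of any maximum
independent set, so this is a case of [pwc_far]. *)
Lemma pwc_closed U m K : private_well_covered U m -> K \subset U ->
  closed_in U K -> exists m', private_well_covered K m'.
Proof.
move=> W sKU /closedP cK.
have i0 : independent e set0 by apply/indepP => u v; rewrite inE.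
have [S [_ sSU iS cS]] := pwc_extend W i0 (sub0set U).
have sIU : S :\: K \subset U := subset_trans (subsetDl _ _) sSU.
have iI : independent e (S :\: K) by apply: indepS iS; exact: subsetDl.
exists (m - #|S :\: K|).
suff E : K = far U (S :\: K).
  by rewrite [X in private_well_covered X]E; exact: pwc_far.
apply/setP => v; rewrite in_far in_setD; apply/idP/and3P.
  move=> vK; rewrite vK (subsetP sKU) //=; split=> //.
  apply/nbrsP => -[u /setDP[uS uK]]; rewrite e_sym => vu.
  by rewrite (cK v u) ?(subsetP sSU) in uK.
case=> vU; rewrite negb_and negbK; case/orP => // vS vN.
apply: contraT => vK.
have : #|S :|: [set v]| <= m.
  apply: (pwc_le W); last by rewrite subUset sSU sub1set.
  apply: indepU => //; first exact: indep1.
  move=> _ /set1P->; apply: contra vN => /nbrsP[u uS uv].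
  apply/nbrsP; exists u => //; rewrite in_setD uS andbT.
  by apply: contra vK => uK; exact: (cK u).
by rewrite setUC cardsU1 vS cS; card_lia.
Qed.

(** In a maximum independent set containing B, the part B can be exchanged for
any independent subset S of the union of components N[B]. *)
Lemma pwc_closed_le U m B S : private_well_covered U m ->
  independent e B -> B \subset U -> closed_in U (cl U B) ->
  independent e S -> S \subset cl U B -> #|S| <= #|B|.
Proof.
move=> W iB sBU /closedP cB iS sS.
have [M [sBM sMU iM cM]] := pwc_extend W iB sBU.
have MB v : v \in M :\: B -> v \notin cl U B.
  move=> /setDP[vM vB]; rewrite in_cl (negPf vB) (subsetP sMU) //=.
  by apply: contra (indep_nbrs iM vM); apply/subsetP/nbrsS.
have sSU := subset_trans sS (cl_sub sBU).
have : #|S :|: (M :\: B)| <= m.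
  apply: (pwc_le W).
    apply: indepU => //; first by apply: indepS iM; exact: subsetDl.
    move=> v vMB; apply: contra (MB v vMB) => /nbrsP[u uS uv].
    apply: cB uv; first exact: (subsetP sS).
    by case/setDP: vMB => /(subsetP sMU).
  by rewrite subUset sSU (subset_trans (subsetDl _ _)).
rewrite cardsU_disjoint; last first.
  rewrite disjoint_subset; apply/subsetP => v /(subsetP sS) vB.
  by rewrite inE; apply/negP => /MB; rewrite vB.
have := subset_leq_card sBM.
by rewrite cardsD (setIidPr sBM) cM; card_lia.
Qed.

(** Removing a from A loses at least the private neighbour of a, so the
deficiency of A exceeds that of A :\ a by at most 1. *)
Lemma deficiency_le1 U m A : private_well_covered U m ->
  independent e A -> A \subset U ->
  (forall B, B \proper A -> 2 * #|B| <= #|nb U B|) ->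
  2 * #|A| <= #|nb U A| + 1.
Proof.
move=> W iA sAU minA.
have [-> | [a aA]] := set_0Vmem A; first by rewrite cards0.
have [b [bU ab bp]] := pwc_private W iA sAU aA.
have ltA : A :\ a \proper A by rewrite properD1.
have := minA _ ltA.
have : nb U (A :\ a) \proper nb U A.
  apply/properP; split; first by apply: nbS; exact: subsetDl.
  exists b; rewrite in_nb bU //=.
  by apply/nbrsP; exists a.
move/proper_card; have := cardsD1 a A; rewrite aA; card_lia.
Qed.

(** * Deficient sets and unions of components *)
Definition contains_closed U A : Prop :=
  exists B, [/\ B \subset A, deficient U B & closed_in U (cl U B)].

Lemma deficient_neq0 U A : deficient U A -> A != set0.
Proof. by case/and3P => _ _; apply: contraTneq => ->; rewrite cards0 muln0. Qed.

Lemma proper_setD A B : B \subset A -> B != set0 -> A :\: B \proper A.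
Proof.
move=> sBA /set0Pn[b bB]; apply/properP; split; first exact: subsetDl.
by exists b; [exact: (subsetP sBA) | rewrite in_setD bB].
Qed.

Lemma deficient_split U K A : K \subset U -> deficient U A ->
  deficient K (A :&: K) \/ deficient (U :\: K) (A :\: K).
Proof.
move=> sKU /and3P[iA sAU dA].
have iAK : independent e (A :&: K) by apply: indepS iA; exact: subsetIl.
have iAK' : independent e (A :\: K) by apply: indepS iA; exact: subsetDl.
rewrite /deficient iAK iAK' subsetIr setSD //=.
have : #|nb K (A :&: K)| <= #|nb U A :&: K|.
  apply/subset_leq_card/subsetP => v; rewrite in_setI !in_nb => /andP[vK vN].
  rewrite vK (subsetP sKU) //= andbT.
  by move: vN; apply/subsetP/nbrsS/subsetIl.
have : #|nb (U :\: K) (A :\: K)| <= #|nb U A :\: K|.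
  apply/subset_leq_card/subsetP => v; rewrite in_setD !in_nb in_setD.
  case/andP => /andP[-> ->] /=.
  by apply/subsetP/nbrsS/subsetDl.
have := cardsID K A; have := cardsID K (nb U A).
case: (ltnP #|nb K (A :&: K)| (2 * #|A :&: K|)) => H; first by left.
by right; card_lia.
Qed.

Lemma contains_closed_closed U K A : K \subset U -> closed_in U K ->
  contains_closed K A -> contains_closed U A.
Proof.
move=> sKU /closedP cK [B [sBA /and3P[iB sBK dB] cB]].
have E : nb U B = nb K B.
  apply/setP => v; rewrite !in_nb; apply/andP/andP => -[vU vN]; split => //.
    by have /nbrsP[u uB uv] := vN; apply: (cK u) => //; exact: (subsetP sBK).
  exact: (subsetP sKU).
have Ec : cl U B = cl K B by rewrite /cl E.
exists B; split => //; first by rewrite /deficient iB E dB (subset_trans sBK).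
apply/closedP => u v; rewrite Ec => uB vU uv.
move/closedP: cB; apply; first exact: uB; last exact: uv.
by apply: (cK u) => //; apply: (subsetP (cl_sub sBK)).
Qed.

(** * A smallest deficient set has no edge leaving its neighbourhood *)
Section Critical.

Variables (U : {set T}) (m : nat) (A S : {set T}) (x y : T).
Hypotheses
  (W : private_well_covered U m)
  (IH : forall U' m' B, U' \proper U -> private_well_covered U' m' ->
     deficient U' B -> contains_closed U' B)
  (defA : deficient U A)
  (minA : forall B, independent e B -> B \subset U -> #|B| < #|A| ->
     2 * #|B| <= #|nb U B|)
  (xA : x \in nb U A) (yA : y \in far U A) (xy : e x y)
  (iS : independent e S) (sSU : S \subset U) (cS : #|S| = m) (xS : x \in S).

Let Uy := far U [set y].
Let X := nb U A :&: nbrs [set y].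

Let iA : independent e A. Proof. by case/and3P: defA. Qed.
Let sAU : A \subset U. Proof. by case/and3P: defA. Qed.
Let yU : y \in U. Proof. exact: (subsetP (far_sub U A)). Qed.
Let yNA : y \notin nbrs A. Proof. by move: yA; rewrite in_far => /and3P[]. Qed.
Let xX : x \in X. Proof. by rewrite in_setI xA nbrs1 e_sym. Qed.

Let in_Uy v : (v \in Uy) = [&& v \in U, v != y & ~~ e y v].
Proof. by rewrite in_far in_set1 nbrs1. Qed.

Let sAUy : A \subset Uy.
Proof.
apply/subsetP => v vA; rewrite in_Uy (subsetP sAU) //=; apply/andP; split.
  by apply: contraTneq yA => <-; rewrite in_far vA andbF.
by apply: contra yNA => yv; apply/nbrsP; exists v => //; rewrite e_sym.
Qed.

Let properUy : Uy \proper U.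
Proof.
apply/properP; split; first exact: far_sub.
by exists y; rewrite ?in_Uy ?eqxx ?andbF.
Qed.

Let WUy : private_well_covered Uy (m - #|[set y]|).
Proof. by apply: pwc_far; rewrite ?indep1 ?sub1set. Qed.

(** The neighbours of B lost when N[y] is deleted are those in X. *)
Lemma card_nb_Uy B : B \subset A -> #|nb U B| = #|nb Uy B| + #|X :&: nbrs B|.
Proof.
move=> sBA; rewrite -(cardsID (nbrs [set y]) (nb U B)) addnC; congr (_ + _).
  apply: eq_card => v; rewrite in_setD !in_nb nbrs1 in_Uy.
  case: eqP => [->|_]; last first.
    by case: (v \in U); case: (e y v); case: (v \in nbrs B).
  suff /negPf-> : y \notin nbrs B by rewrite !andbF.
  by apply: contra yNA; apply/subsetP/nbrsS.
apply: eq_card => v; rewrite [LHS]in_setI [RHS]in_setI [in RHS]in_setI !in_nb.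
have := subsetP (nbrsS sBA) v.
case: (v \in nbrs B) => [->//|_]; first by rewrite !andbT.
by rewrite !andbF.
Qed.

(** Deficiency exactly 1 in U means deficiency |X| + 1 in Uy. *)
Lemma card_nb_critical : #|nb Uy A| + #|X| + 1 = 2 * #|A|.
Proof.
have D1 : 2 * #|A| <= #|nb U A| + 1.
  apply: (deficiency_le1 W) => // B pBA.
  apply: minA; last exact: proper_card.
    by apply: indepS iA; exact: proper_sub.
  exact: subset_trans (proper_sub pBA) sAU.
have := card_nb_Uy (subxx A).
have -> : X :&: nbrs A = X.
  by apply/setIidPl; rewrite /X /nb -setIA setIC -setIA subsetIl.
by case/and3P: defA; card_lia.
Qed.

(** The heart of the argument: closedness in Uy comes from the induction
hypothesis and inclusion-minimality.  Separation from [far U A] comes from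
applying the induction hypothesis a second time, in G - N[A :\: B]. *)
Lemma piece_separated B : B \subset A -> minset (deficient Uy) B ->
  [/\ #|nb Uy B| + 1 = 2 * #|B|, closed_in Uy (cl Uy B) &
    forall u v, u \in cl Uy B -> v \in far U A -> ~~ e u v].
Proof.
move=> sBA /minsetP[dB minB].
have [B' [sB' dB' cB]] := IH properUy WUy dB.
rewrite (minB B') // in cB => {B' sB' dB'}.
have /and3P[iB sBUy ltB] := dB.
have cardB : #|nb Uy B| + 1 = 2 * #|B|.
  have : 2 * #|B| <= #|nb Uy B| + 1; last by card_lia.
  apply: (deficiency_le1 WUy) => // B' pB'.
  rewrite leqNgt; apply/negP => ltB'.
  have sB' := proper_sub pB'.
  have EB : B' = B.
    by apply: minB; rewrite // /deficient ltB' (indepS sB') ?(subset_trans sB').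
  by rewrite EB properxx in pB'.
have clB v : v \in A :\: B -> v \notin cl Uy B.
  case/setDP => vA vB; rewrite in_cl (negPf vB) /= negb_and orbC.
  by rewrite (contra _ (indep_nbrs iA vA)) //; apply/subsetP/nbrsS.
(* In Uy the rest of A keeps deficiency |X|, but in U it is not deficient:
   it must be adjacent to all of X. *)
have XR : X \subset nbrs (A :\: B).
  have sRA := subsetDl A B.
  apply/setIidPl/eqP; rewrite eqEcard subsetIl /=.
  have : 2 * #|A :\: B| <= #|nb U (A :\: B)|.
    apply: minA; [exact: indepS iA | exact: subset_trans sAU |].
    by apply/proper_card/proper_setD; rewrite ?(deficient_neq0 dB).
  have : #|nb Uy B| + #|nb Uy (A :\: B)| <= #|nb Uy A|.
    rewrite -cardsU_disjoint.
      by apply: subset_leq_card; rewrite subUset !nbS.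
    rewrite disjoint_subset; apply/subsetP => v vB; rewrite inE in_nb.
    apply/negP => /andP[vUy /nbrsP[u uR uv]].
    have := clB u uR; rewrite (closedP _ _ cB v u) //.
    - by rewrite in_setU vB orbT.
    - by apply: (subsetP sAUy); case/setDP: uR.
    - by rewrite e_sym.
  have := card_nb_Uy sRA; have := card_nb_critical.
  have := cardsD A B; have := subset_leq_card sBA; rewrite (setIidPr sBA).
  by card_lia.
split=> //; set R := A :\: B in clB XR.
have sRA : R \subset A := subsetDl A B.
have sRU := subset_trans sRA sAU.
have iR : independent e R := indepS sRA iA.
have pUR : far U R \proper U.
  apply/properP; split; first exact: far_sub.
  exists x; first by move: xA; rewrite in_nb => /andP[].
  by rewrite in_far (subsetP XR) // !andbF.
have sBUR : B \subset far U R.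
  apply/subsetP => v vB; have vA := subsetP sBA v vB.
  rewrite in_far (subsetP sAU) // in_setD vB /=.
  by apply: contra (indep_nbrs iA vA); apply/subsetP/nbrsS.
(* The neighbours of B outside Uy lie in X, hence in the neighbourhood of R. *)
have sNB : nb (far U R) B \subset nb Uy B.
  apply/subsetP => v; rewrite !in_nb in_Uy => /andP[+ vB].
  rewrite vB in_far andbT => /and3P[vU vR vNR].
  have vNA : v \in nbrs A by move: vB; apply/subsetP/nbrsS.
  rewrite vU /=; apply/andP; split; first by apply: contraNneq yNA => <-.
  apply: contra vNR => yv; apply: (subsetP XR).
  by rewrite in_setI in_nb vU vNA nbrs1.
have clUR v : v \in cl Uy B -> v \in far U R.
  rewrite in_cl => /orP[/(subsetP sBUR)//|/andP[vUy vB]].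
  have vcl : v \in cl Uy B by rewrite in_cl vUy vB orbT.
  rewrite in_far (subsetP (far_sub _ _) _ vUy) /=; apply/andP; split.
    by apply: contraL vcl; exact: clB.
  apply/nbrsP => -[u uR uv].
  have := clB u uR; rewrite (closedP _ _ cB v u) ?vcl 1?e_sym //.
  by apply: (subsetP sAUy); exact: (subsetP sRA).
have dBR : deficient (far U R) B.
  by rewrite /deficient iB sBUR; have := subset_leq_card sNB; card_lia.
have [B' [sB' /and3P[iB' _ ltB'] cB']] := IH pUR (pwc_far W iR sRU) dBR.
rewrite (minB B') // in cB'; last first.
  rewrite /deficient iB' (subset_trans sB' sBUy) /=.
  apply: leq_ltn_trans ltB'; apply/subset_leq_card/subsetP => v.
  rewrite !in_nb => /andP[vUy vB']; rewrite vB' andbT; apply: clUR.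
  by rewrite in_cl vUy (subsetP (nbrsS sB')) // orbT.
move=> u v uB vF; apply/negP => uv.
have /and3P[vU vA vNA] : [&& v \in U, v \notin A & v \notin nbrs A].
  by rewrite -in_far.
have := closedP _ _ cB' u v.
have -> : u \in cl (far U R) B.
  move: (uB); rewrite !in_cl (clUR u uB) /=.
  by case: (u \in B) => //= /andP[].
have -> : v \in far U R.
  rewrite in_far vU /=; apply/andP; split.
    by apply: contra vA => /(subsetP sRA).
  by apply: contra vNA; apply/subsetP/nbrsS.
move/(_ isT isT uv); rewrite in_cl => /orP[vB|/andP[_ vB]].
  by rewrite (subsetP sBA) in vA.
by rewrite (subsetP (nbrsS sBA)) in vNA.
Qed.

(** The last inequality says that A' has in Uy at least the deficiency of F
minus the number of vertices that S lacks, |F| - |S :&: cl Uy F|.  Subtractions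
are moved across to stay within natural numbers.  The property is additive
over pieces, so it can be accumulated up to F = A. *)
Definition transferable F : Prop :=
  [/\ F \subset A, closed_in Uy (cl Uy F),
    forall u v, u \in cl Uy F -> v \in far U A -> ~~ e u v &
    exists A', A' \subset S :&: cl Uy F /\
      #|F| + #|S :&: cl Uy F| + #|nb Uy A'| <= 2 * #|A'| + #|nb Uy F|].

Lemma closed_disjoint F B : F \subset A -> B \subset A :\: F ->
  closed_in Uy (cl Uy F) -> [disjoint cl Uy F & cl Uy B].
Proof.
move=> sFA sBR /closedP cF.
have out v : v \in B -> v \notin cl Uy F.
  move=> /(subsetP sBR)/setDP[vA vF]; rewrite in_cl (negPf vF) /= negb_and orbC.
  by rewrite (contra _ (indep_nbrs iA vA)) //; apply/subsetP/nbrsS.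
rewrite disjoint_subset; apply/subsetP => v vF; rewrite inE in_cl negb_or.
apply/andP; split; first by apply: contraL vF; exact: out.
apply/andP => -[_ /nbrsP[u uB uv]].
have := out u uB; rewrite (cF v) // 1?e_sym //.
by apply: (subsetP sAUy); case/setDP: (subsetP sBR u uB).
Qed.

(** On a single piece B: if S meets it in |B| vertices, that trace has in Uy at
most as many neighbours as B, all of them lying in N[B]; otherwise the empty set
will do, since the deficiency 1 of B is offset by the vertex that S lacks. *)
Lemma transferable_add F B : transferable F -> B \subset A :\: F ->
  minset (deficient Uy) B -> transferable (F :|: B).
Proof.
move=> [sFA cF sepF [A1 [sA1 cA1]]] sBR minB.
have [dB _] := minsetP minB.
have sBA : B \subset A := subset_trans sBR (subsetDl _ _).
have [cardB cB sepB] := piece_separated sBA minB.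
have dis := closed_disjoint sFA sBR cF.
have subcl K : K \subset cl Uy K by exact: subsetUl.
have subnb K : nb Uy K \subset cl Uy K by exact: subsetUr.
split; first by rewrite subUset sFA.
- apply/closedP => u v; rewrite clU => /setUP[uF|uB] vUy uv; apply/setUP.
    by left; exact: (closedP _ _ cF u).
  by right; exact: (closedP _ _ cB u).
- by move=> u v; rewrite clU => /setUP[]; [exact: sepF | exact: sepB].
pose A2 := if #|S :&: cl Uy B| == #|B| then S :&: cl Uy B else set0.
have sA2 : A2 \subset S :&: cl Uy B.
  by rewrite /A2; case: ifP => _ //; exact: sub0set.
have cA2 : #|B| + #|S :&: cl Uy B| + #|nb Uy A2| <= 2 * #|A2| + #|nb Uy B|.
  have /and3P[iB sBUy _] := dB.
  rewrite /A2; case: eqP => [E|NE].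
    have iA2 : independent e (S :&: cl Uy B) := indepS (subsetIl _ _) iS.
    have : #|nb Uy (S :&: cl Uy B)| + #|S :&: cl Uy B| <= #|cl Uy B|.
      rewrite addnC -(card_cl _ iA2); apply/subset_leq_card/subsetP => v.
      rewrite in_cl => /orP[/setIP[]//|/andP[vUy /nbrsP[u /setIP[_ uB] uv]]].
      exact: (closedP _ _ cB u).
    by rewrite card_cl // E; card_lia.
  have : #|S :&: cl Uy B| <= #|B|.
    apply: (pwc_closed_le WUy) => //; last exact: subsetIr.
    exact: indepS (subsetIl _ _) iS.
  by rewrite nb0 !cards0; move: NE; card_lia.
exists (A1 :|: A2); rewrite clU setIUr; split; first exact: setUSS.
have d1 : [disjoint F & B] := disjointW (subcl _) (subcl _) dis.
have d2 : [disjoint nb Uy F & nb Uy B] := disjointW (subnb _) (subnb _) dis.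
have d3 : [disjoint S :&: cl Uy F & S :&: cl Uy B] :=
  disjointW (subsetIr _ _) (subsetIr _ _) dis.
have d4 : [disjoint A1 & A2] := disjointW sA1 sA2 d3.
rewrite !nbU (cardsU_disjoint d1) (cardsU_disjoint d2) (cardsU_disjoint d3).
rewrite (cardsU_disjoint d4).
by have [leN _] := leq_card_setU (nb Uy A1) (nb Uy A2); card_lia.
Qed.

(** As long as F is a proper subset of A its deficiency in Uy is at most |X|, so
A :\: F is deficient there and contains a further piece. *)
Lemma transferable_all : transferable A.
Proof.
suff grow n F : #|A :\: F| <= n -> transferable F -> transferable A.
  apply: (grow _ set0 (leqnn _)); split; first exact: sub0set.
  - by apply/closedP => u v; rewrite /cl nb0 set0U in_set0.
  - by move=> u v; rewrite /cl nb0 set0U in_set0.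
  - by exists set0; rewrite sub0set /cl nb0 setU0 setI0 !cards0.
elim: n F => [|n IHn] F.
  rewrite leqn0 cards_eq0 setD_eq0 => sAF tF.
  suff -> : A = F by [].
  by apply/eqP; rewrite eqEsubset sAF; case: tF.
move=> cF tF; have [sFA clF _ _] := tF.
have [EF | neF] := eqVneq F A; first by rewrite -EF.
have pF : F \proper A by rewrite properEneq neF.
have dR : deficient Uy (A :\: F).
  have sRA := subsetDl A F.
  rewrite /deficient (indepS sRA) // (subset_trans sRA) //=.
  have : 2 * #|F| <= #|nb U F|.
    apply: minA; last exact: proper_card.
      exact: indepS iA.
    exact: subset_trans sAU.
  have : #|X :&: nbrs F| <= #|X| by apply/subset_leq_card/subsetIl.
  have : #|nb Uy F| + #|nb Uy (A :\: F)| <= #|nb Uy A|.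
    rewrite -cardsU_disjoint.
      by apply: subset_leq_card; rewrite subUset !nbS.
    by apply: disjointW (closed_disjoint sFA (subxx _) clF); exact: subsetUr.
  have := card_nb_Uy sFA; have := card_nb_critical.
  have := cardsD A F; have := subset_leq_card sFA; rewrite (setIidPr sFA).
  by card_lia.
have [B minB sBR] := minset_exists dR; have [dB _] := minsetP minB.
apply: (IHn (F :|: B)); last exact: transferable_add.
rewrite -ltnS; apply: leq_trans cF; apply: proper_card.
by rewrite -setDDl; apply: proper_setD; rewrite ?(deficient_neq0 dB).
Qed.

(** The edge xy would leave N[A].  The set A' obtained from F = A is adjacent to
no vertex of [far U A], nor to X :&: S; counting the vertices of S in N[A] shows
it too deficient for a set of at most |A| vertices. *)
Lemma smallest_deficient_no_exit : False.
Proof.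
have [_ cA sepA [A' [sA' cardA']]] := transferable_all.
have /subsetIP[sA'S sA'cl] := sA'.
have iA' : independent e A' := indepS sA'S iS.
have sA'U : A' \subset U := subset_trans sA'S sSU.
have leA' : #|S :&: cl Uy A| <= #|A|.
  apply: (pwc_closed_le WUy) => //; last exact: subsetIr.
  exact: indepS (subsetIl _ _) iS.
have lt1 := subset_leq_card sA'.
have cN : #|nb U A'| <= #|nb Uy A'| + #|X :\: S|.
  apply: leq_trans (leq_card_setU _ _); apply/subset_leq_card/subsetP => v.
  rewrite in_nb => /andP[vU vN]; rewrite in_setU in_nb in_Uy vU vN /= andbT.
  have /nbrsP[u uA' uv] := vN.
  have vnF : v \notin far U A.
    by apply: contraL uv => vF; apply: sepA => //; exact: (subsetP sA'cl).
  have -> /= : v != y by apply: contraNneq vnF => ->.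
  case yv: (e y v) => //=.
  have vS : v \notin S.
    by apply: contraL vN => /(indep_nbrs iS); apply/contra/subsetP/nbrsS.
  rewrite in_setD vS in_setI in_nb nbrs1 yv vU andbT /=.
  move: vnF; rewrite in_far vU /= negb_and !negbK => /orP[vA|//].
  by have := subsetP sAUy v vA; rewrite in_Uy yv !andbF.
have cX := cardsID S X.
have splitS : #|S :&: (A :|: nb U A)| <= #|S :&: cl Uy A| + #|X :&: S|.
  apply: leq_trans (leq_card_setU _ _); apply/subset_leq_card/subsetP => v.
  move=> /setIP[vS /setUP[vA|]].
    by apply/setUP; left; rewrite in_setI vS in_cl vA.
  rewrite in_nb => /andP[vU vN]; apply/setUP.
  case yv: (e y v); [right | left]; apply/setIP; split => //.
    by apply/setIP; split; rewrite ?nbrs1 // in_nb vU.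
  rewrite in_cl in_Uy vU vN yv /= !andbT.
  by have -> : v != y; [apply: contraNneq yNA => <- | rewrite orbT].
(* Otherwise exchanging the part of S in N[A] for A would give an independent
   set larger than S. *)
have geS : #|A| <= #|S :&: (A :|: nb U A)|.
  have : #|A :|: (S :\: (A :|: nb U A))| <= m.
    apply: (pwc_le W); last first.
      by rewrite subUset sAU (subset_trans (subsetDl _ _)).
    apply: indepU => //; first by apply: indepS iS; exact: subsetDl.
    move=> v /setDP[vS]; rewrite in_setU in_nb (subsetP sSU) // negb_or.
    by case/andP.
  rewrite cardsU_disjoint; last first.
    rewrite disjoint_subset; apply/subsetP => v vA.
    by rewrite inE in_setD in_setU vA.
  by have := cardsID (A :|: nb U A) S; card_lia.
have xXS : 0 < #|X :&: S| by apply/card_gt0P; exists x; rewrite in_setI xX.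
have crit := card_nb_critical.
have [ltA|geA] := ltnP #|A'| #|A|.
  by have := minA iA' sA'U ltA; card_lia.
have : 2 * #|A'| <= #|nb U A'| + 1; last by card_lia.
apply: (deficiency_le1 W) => // B pB; apply: minA.
- by apply: indepS iA'; exact: proper_sub.
- exact: subset_trans (proper_sub pB) sA'U.
- by have := proper_card pB; card_lia.
Qed.

End Critical.

(** * Closed deficient sets exist *)
Lemma smallest_deficient_closed U m A : private_well_covered U m ->
  (forall U' m' B, U' \proper U -> private_well_covered U' m' ->
     deficient U' B -> contains_closed U' B) ->
  deficient U A -> (forall B, deficient U B -> #|A| <= #|B|) ->
  closed_in U (cl U A).
Proof.
move=> W IH dA minA; have /and3P[iA sAU _] := dA.
apply/closedP => x y xA yU xy; apply: contraT => yA.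
have xN : x \in nb U A.
  case/setUP: xA => // xA; case/negP: yA; rewrite in_cl yU orbC /=.
  by have -> : y \in nbrs A by apply/nbrsP; exists x.
have xU : [set x] \subset U by rewrite sub1set; case/setIP: xN.
have [S [sxS sSU iS cS]] := pwc_extend W (indep1 x) xU.
exfalso; apply: (smallest_deficient_no_exit W IH dA _ xN _ xy iS sSU cS).
- move=> B iB sBU ltB; rewrite leqNgt; apply: contraL ltB => ltB.
  by rewrite -leqNgt minA // /deficient iB sBU.
- by rewrite in_setD yA.
- by rewrite -sub1set.
Qed.

(** A smallest deficient set A0 spans a union of components K.  If K is proper,
A is deficient in K or in its complement and induction applies; if K is
everything, A0 is a maximum independent set, so A is itself smallest. *)
Lemma deficient_contains_closed U m A : private_well_covered U m ->
  deficient U A -> contains_closed U A.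
Proof.
have [n] := ubnP #|U|; elim: n => // n IHn in U m A * => /ltnSE leUn W dA.
have IH U' m' B : U' \proper U -> private_well_covered U' m' ->
    deficient U' B -> contains_closed U' B.
  by move=> pU' W'; apply: IHn W'; exact: leq_trans (proper_card pU') leUn.
case: (arg_minnP (fun B : {set T} => #|B|) dA) => A0 dA0 minA0.
have cK := smallest_deficient_closed W IH dA0 minA0.
have /and3P[iA0 sA0U _] := dA0; have /and3P[iA sAU _] := dA.
have sKU := cl_sub sA0U.
have [EK | neK] := eqVneq (cl U A0) U.
  have leA : #|A| <= #|A0|.
    by apply: (pwc_closed_le W iA0 sA0U cK iA); rewrite EK.
  exists A; split => //; apply: (smallest_deficient_closed W IH dA) => B dB.
  exact: leq_trans leA (minA0 B dB).
have pK : cl U A0 \proper U by rewrite properEneq neK.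
have cK' : closed_in U (U :\: cl U A0).
  apply/closedP => u v /setDP[uU uK] vU uv; rewrite in_setD vU andbT.
  by apply: contra uK => vK; apply: (closedP _ _ cK v); rewrite // e_sym.
have pK' : U :\: cl U A0 \proper U.
  apply: proper_setD => //; apply: contraNneq (deficient_neq0 dA0) => K0.
  by rewrite -subset0 -K0 subsetUl.
have step K : K \proper U -> closed_in U K -> deficient K (A :&: K) ->
    contains_closed U A.
  move=> pK0 cK0 dK; have sK0 := proper_sub pK0.
  have [m' W'] := pwc_closed W sK0 cK0.
  have [B [sB dB cB]] := contains_closed_closed sK0 cK0 (IH _ _ _ pK0 W' dK).
  by exists B; split => //; apply: subset_trans sB _; exact: subsetIl.
case: (deficient_split sKU dA) => dK; first exact: step dK.
by apply: (step (U :\: cl U A0)); rewrite // setIDA (setIidPl sAU).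
Qed.

(** * Connected graphs in W_2 *)
Lemma alpha_max A : independent e A -> #|A| <= alpha e.
Proof.
by move=> iA; apply: (leq_bigmax_cond (F := fun B : {set T} => #|B|)).
Qed.

Lemma W2_pair A B : in_W 2 e -> independent e A -> independent e B ->
  [disjoint A & B] -> exists S1 S2, [/\ maximum_independent e S1,
    maximum_independent e S2, [disjoint S1 & S2], A \subset S1 & B \subset S2].
Proof.
move=> [_ _ W] iA iB dAB.
have [||S [mS dS sS]] := W (fun i : 'I_2 => if i == 0 :> nat then A else B).
- by move=> i; case: ifP.
- move=> [[|[|?]] ?] [[|[|?]] ?] //=; rewrite -?val_eqE //=.
  by rewrite disjoint_sym.
exists (S ord0), (S ord_max); split=> //.
- exact: dS.
- exact: (sS ord0).
- exact: (sS ord_max).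
Qed.

Lemma W2_private_well_covered :
  in_W 2 e -> private_well_covered [set: T] (alpha e).
Proof.
move=> W.
have i0 : independent e set0 by apply/indepP => u v; rewrite inE.
split.
- by move=> J iJ _; exact: alpha_max.
- move=> J iJ _.
  have [|S [_ [/andP[iS /eqP cS] _ _ sJS _]]] := W2_pair W iJ i0.
    by rewrite disjoint_sym disjoints_subset sub0set.
  by exists S; split.
move=> J a iJ _ aJ.
have iJ' : independent e (J :\ a) := indepS (subsetDl _ _) iJ.
have [|S1 [S2 [_ /andP[iS2 /eqP cS2] dS aS1 sJS2]]] := W2_pair W (indep1 a) iJ'.
  by rewrite disjoints1 setD11.
(* S2 misses a but cannot be enlarged by it, so a has a neighbour b in S2;
   being in S2, b is adjacent to nothing in J :\ a. *)
have aS2 : a \notin S2.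
  by rewrite (disjointFr dS) // -sub1set.
have [aN | aN] := boolP (a \in nbrs S2); last first.
  have : #|S2 :|: [set a]| <= alpha e.
    by apply/alpha_max/indepU => // [|_ /set1P-> //]; exact: indep1.
  by rewrite setUC cardsU1 aS2 cS2 add1n ltnn.
have /nbrsP[b bS2 ba] := aN; exists b.
split; [exact: in_setT | by rewrite e_sym |].
by apply: contra (indep_nbrs iS2 bS2); apply/subsetP/nbrsS.
Qed.

Lemma open_nbhdE A : independent e A -> open_nbhd e A = nb [set: T] A.
Proof.
move=> iA; apply/setP => v; rewrite in_nb !inE /=.
have := @indep_nbrs A v iA; rewrite inE.
by case: (v \in A) => //= /(_ isT)/negPf->.
Qed.

Lemma connected_closed K : (forall x y, connect e x y) ->
  closed_in [set: T] K -> K != set0 -> K = [set: T].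
Proof.
move=> conn /closedP cK /set0Pn[x xK]; apply/setP => y; rewrite in_setT.
have /connectP[p] := conn x y.
elim: p x xK => [|z p IHp] x xK /=; first by move=> _ ->.
by case/andP => xz; apply: IHp; exact: cK xz.
Qed.

End Graph.

Theorem theorem5p1 (R : realType) (T : finType) (e : rel T)
    (e_sym : symmetric e) (e_irr : irreflexive e)
    (e_conn : connected_graph e) (e_W2 : in_W 2 e) :
  quasi_regularizable (2%:R : R)%R e <-> (3 * alpha e <= #|T|)%N.
Proof.
have W := W2_private_well_covered e_sym e_irr e_W2.
split.
  move=> [_ qr].
  have i0 : independent e set0 by apply/indepP => u v; rewrite inE.
  have [S [_ _ iS cS]] := pwc_extend W i0 (sub0set _).
  have := qr S iS; rewrite -GRing.natrM Num.Theory.ler_nat open_nbhdE //.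
  have := max_card (mem (cl e [set: T] S)); rewrite card_cl // cS.
  card_lia.
move=> le3; split; first by rewrite Num.Theory.ltr0n.
move=> A iA; rewrite -GRing.natrM Num.Theory.ler_nat open_nbhdE // leqNgt.
apply/negP => ltA.
have dA : deficient e [set: T] A by rewrite /deficient iA subsetT.
have [B [_ dB cB]] := deficient_contains_closed e_sym e_irr W dA.
have /and3P[iB _ ltB] := dB.
have [_ conn] := e_conn.
have ET : cl e [set: T] B = [set: T].
  apply: connected_closed conn cB _.
  by apply: contraNneq (deficient_neq0 dB) => K0; rewrite -subset0 -K0 subsetUl.
have := card_cl [set: T] iB; rewrite ET cardsT.
by have := alpha_max iB; card_lia.
Qed.
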